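(* Let $k$ be a field of characteristic $2$ and let $L$ be a Lie algebra over $k$ with a basis $\{e_1,e_2,e_3\}$ such that $[e_1,e_2]=0$, $[e_1,e_3]=e_1+\beta e_2$, $[e_2,e_3]=\delta e_2$, where $\beta,\delta\in k$. Let $r\in L\otimes L$. Then: (I) If $r$ is strongly symmetric, then $r$ is a solution of the classical Yang-Baxter equation (CYBE) in $L$. (II) If $\beta=0$ and $\delta\neq 0$, then $r$ is a solution of CYBE in $L$ if and only if there are $p,q,s,u,x,y,z\in k$ with $$r=p(e_1\otimes e_2)+q(e_2\otimes e_1)+s(e_1\otimes e_3)+s(e_3\otimes e_1)+u(e_2\otimes e_3)+u(e_3\otimes e_2)+x(e_1\otimes e_1)+y(e_2\otimes e_2)+z(e_3\otimes e_3),$$ where $(\delta+1)zp=(\delta+1)qz=(\delta+1)us$, $(\delta+1)uq=(\delta+1)up$ and $(\delta+1)ps=(\delta+1)qs$. (III) If $\beta\neq 0$ and $\delta=1$, then $r$ is a solution of CYBE in $L$ if and only if there are $p,q,s,u,x,y,z\in k$ with $$r=p(e_1\otimes e_2)+q(e_2\otimes e_1)+s(e_1\otimes e_3)+s(e_3\otimes e_1)+u(e_2\otimes e_3)+u(e_3\otimes e_2)+x(e_1\otimes e_1)+y(e_2\otimes e_2)+z(e_3\otimes e_3),$$ where $sp=sq$, $up=qu$, $zq=zp$ and $s^2=xz$. (IV) If $\beta=\delta=0$, then $r$ is a solution of CYBE in $L$ if and only if there are $p,q,s,u,v,x,y,z\in k$ with $$r=p(e_1\otimes e_2)+q(e_2\otimes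 e_1)+s(e_1\otimes e_3)+s(e_3\otimes e_1)+u(e_2\otimes e_3)+v(e_3\otimes e_2)+x(e_1\otimes e_1)+y(e_2\otimes e_2)+z(e_3\otimes e_3),$$ where $vs=pz$, $us=qz$, $qv=pu$ and $(u+v)x=(p+q)s$.
   Context: All tensor products are over $k$. Strongly symmetric: $r=\sum_{i,j}k_{ij}(e_i\otimes e_j)$ with $k_{ij}\in k$ is strongly symmetric if $k_{ij}=k_{ji}$ and $k_{ij}k_{lm}=k_{il}k_{jm}$ for all indices $i,j,l,m$ (this does not depend on the choice of basis). CYBE: for $r=\sum_i a_i\otimes b_i\in L\otimes L$, put $[r^{12},r^{13}]=\sum_{i,j}[a_i,a_j]\otimes b_i\otimes b_j$, $[r^{12},r^{23}]=\sum_{i,j}a_i\otimes[b_i,a_j]\otimes b_j$, $[r^{13},r^{23}]=\sum_{i,j}a_i\otimes a_j\otimes[b_i,b_j]$. Then $r$ is a solution of CYBE in $L$ if $[r^{12},r^{13}]+[r^{12},r^{23}]+[r^{13},r^{23}]=0$. *)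

(* Defs.v *)
From HB Require Import structures.
From mathcomp Require Import all_boot all_order all_algebra.

Set Implicit Arguments.
Unset Strict Implicit.
Unset Printing Implicit Defensive.

Import GRing.Theory.
Local Open Scope ring_scope.

(* The bracket is required to be alternating, not merely antisymmetric: this  *)
(* is the usual definition, and is strictly stronger in characteristic 2.     *)
HB.mixin Record Vector_isLie (k : fieldType) L of Vector k L := {
  lie_bracket : L -> L -> L;
  lie_bracket_bilinear : bilinear_for *:%R *:%R lie_bracket;
  lie_bracketxx : forall x, lie_bracket x x = 0;
  lie_jacobi : forall x y z,
    lie_bracket x (lie_bracket y z) + lie_bracket y (lie_bracket z x)
      + lie_bracket z (lie_bracket x y) = 0
}.

#[short(type="lieAlgType")]
HB.structure Definition LieAlgebra (k : fieldType) :=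
  { L of Vector_isLie k L & Vector k L }.

HB.instance Definition _ (k : fieldType) (L : lieAlgType k) :=
  bilinear_isBilinear.Build k L L L *:%R *:%R (@lie_bracket k L)
    lie_bracket_bilinear.

Notation "[ 'lie' x , y ]" := (lie_bracket x y)
  (at level 0, x, y at level 99, format "[ 'lie'  x ,  y ]") : ring_scope.

Section Tensor.
Import VectorInternalTheory.
Variable k : fieldType.

(* The tensor product over k of two finite-dimensional spaces, modelled by    *)
(* matrices: u ⊗ v is the outer product of the coordinate vectors of u and v  *)
(* in the reference bases of U and V. tensor_universal below shows that this  *)
(* has the universal property, so that the reference bases are immaterial.    *)
Definition tensor (U V : vectType k) : vectType k := 'M[k]_(dim U, dim V).

Definition tens (U V : vectType k) (u : U) (v : V) : tensor U V :=
  (v2r u)^T *m v2r v.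

Local Notation "u ⊗ v" := (tens u v) (at level 40, no associativity).

Lemma tens_bilinear (U V : vectType k) :
  bilinear_for *:%R *:%R (@tens U V).
Proof.
split=> [v a u1 u2|u a v1 v2] /=; rewrite /tens.
  by rewrite linearP linearP /= mulmxDl -scalemxAl.
by rewrite linearP mulmxDr -scalemxAr.
Qed.

HB.instance Definition _ (U V : vectType k) :=
  bilinear_isBilinear.Build k U V (tensor U V) *:%R *:%R (@tens U V)
    (tens_bilinear U V).

Lemma tens_basis (U V : vectType k) (r : tensor U V) :
  r = \sum_i \sum_j (r : 'M[k]_(dim U, dim V)) i j *:
        (r2v (delta_mx 0 i) ⊗ r2v (delta_mx 0 j)).
Proof.
rewrite {1}(matrix_sum_delta (r : 'M[k]_(dim U, dim V))).
apply: eq_bigr => i _; apply: eq_bigr => j _; congr (_ *: _).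
by rewrite /tens !r2vK trmx_delta mul_delta_mx.
Qed.

Lemma bilinear_sum (U V W : vectType k) (f : U -> V -> W) :
    bilinear_for *:%R *:%R f ->
  forall m n (a : 'I_m -> k) (x : 'I_m -> U) (b : 'I_n -> k) (y : 'I_n -> V),
  f (\sum_i a i *: x i) (\sum_j b j *: y j)
    = \sum_i \sum_j (a i * b j) *: f (x i) (y j).
Proof.
move=> [fl fr] m n a x b y.
pose lf v := GRing.isLinear.Build k U W _ (f^~ v) (fl v).
pose rf u := GRing.isLinear.Build k V W _ (f u) (fr u).
pose Lf v : {linear U -> W} := HB.pack (f^~ v) (lf v).
pose Rf u : {linear V -> W} := HB.pack (f u) (rf u).
rewrite -[LHS]/(Lf _ _) linear_sum; apply: eq_bigr => i _.
have -> : Lf (\sum_j b j *: y j) (a i *: x i)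
    = a i *: Rf (x i) (\sum_j b j *: y j) by rewrite linearZ.
rewrite linear_sum scaler_sumr.
by apply: eq_bigr => j _; rewrite linearZ scalerA.
Qed.

Lemma tensor_universal (U V W : vectType k) (f : U -> V -> W) :
    bilinear_for *:%R *:%R f ->
  exists g : {linear tensor U V -> W},
    (forall u v, g (u ⊗ v) = f u v) /\
    (forall g' : {linear tensor U V -> W},
       (forall u v, g' (u ⊗ v) = f u v) -> g' =1 g).
Proof.
move=> fP.
pose g0 (r : tensor U V) : W :=
  \sum_i \sum_j (r : 'M[k]_(dim U, dim V)) i j *:
     f (r2v (delta_mx 0 i)) (r2v (delta_mx 0 j)).
have g0P : linear g0.
  move=> a r s; rewrite /g0 scaler_sumr -big_split; apply: eq_bigr => i _ /=.
  rewrite scaler_sumr -big_split; apply: eq_bigr => j _ /=.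
  by rewrite !mxE scalerDl scalerA.
pose lg := GRing.isLinear.Build k (tensor U V) W _ g0 g0P.
pose g : {linear tensor U V -> W} := HB.pack g0 lg.
have coordE (X : vectType k) (u : X) :
    u = \sum_i v2r u 0 i *: r2v (delta_mx 0 i).
  rewrite -{1}[u]v2rK {1}(row_sum_delta (v2r u)) linear_sum.
  by apply: eq_bigr => i _; rewrite linearZ.
exists g; split=> [u v|g' g'P r].
  rewrite [in RHS](coordE U u) [in RHS](coordE V v) bilinear_sum //.
  apply: eq_bigr => i _; apply: eq_bigr => j _; congr (_ *: _).
  by rewrite /tens !mxE big_ord1 !mxE.
rewrite [in LHS](tens_basis r) linear_sum; apply: eq_bigr => i _.
rewrite linear_sum; apply: eq_bigr => j _.
by rewrite linearZ g'P.
Qed.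

End Tensor.

Notation "u ⊗ v" := (tens u v) (at level 40, no associativity) : ring_scope.

Section YangBaxter.
Import VectorInternalTheory.
Variables (k : fieldType) (L : lieAlgType k).
Implicit Types (s : seq (L * L)) (r : tensor L L).

(* s = [:: (a_1, b_1); (a_2, b_2); ...] presents the element                  *)
(* \sum_i a_i ⊗ b_i of L ⊗ L.                                                 *)
Definition presents s r : Prop := r = \sum_(p <- s) p.1 ⊗ p.2.

(* L ⊗ L ⊗ L is read as L ⊗ (L ⊗ L).                                          *)
Definition lie_r12_r13 s : tensor L (tensor L L) :=
  \sum_(p <- s) \sum_(q <- s) [lie p.1, q.1] ⊗ (p.2 ⊗ q.2).

Definition lie_r12_r23 s : tensor L (tensor L L) :=
  \sum_(p <- s) \sum_(q <- s) p.1 ⊗ ([lie p.2, q.1] ⊗ q.2).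

Definition lie_r13_r23 s : tensor L (tensor L L) :=
  \sum_(p <- s) \sum_(q <- s) p.1 ⊗ (q.1 ⊗ [lie p.2, q.2]).

Definition yang_baxter s : tensor L (tensor L L) :=
  lie_r12_r13 s + lie_r12_r23 s + lie_r13_r23 s.

(* By presents_ex and CYBE_presents below, one may equivalently take any      *)
(* single presentation of r.                                                  *)
Definition CYBE_solution r : Prop :=
  forall s, presents s r -> yang_baxter s = 0.

Definition strongly_symmetric n (e : n.-tuple L) r : Prop :=
  exists K : 'M[k]_n,
    [/\ r = \sum_i \sum_j K i j *: (tnth e i ⊗ tnth e j),
        forall i j, K i j = K j i
      & forall i j l m, K i j * K l m = K i l * K j m].

Lemma presents_ex r : exists s, presents s r.
Proof.
have tZ (a : k) (u v : L) : a *: (u ⊗ v) = (a *: u) ⊗ v.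
  by rewrite linearZl_LR.
rewrite (tens_basis r) pair_big /=.
set F := BIG_F; pose a (p : 'I_(dim L) * 'I_(dim L)) : L * L :=
  ((r : 'M[k]_(dim L, dim L)) p.1 p.2 *: r2v (delta_mx 0 p.1),
   r2v (delta_mx 0 p.2)).
exists [seq a p | p <- index_enum _]; rewrite /presents big_map.
by apply: eq_bigr => p _; rewrite /F /= tZ.
Qed.

(* Two nested sums over the same presentation are two successive applications *)
(* of linear maps to r.                                                       *)
Lemma double_sum_presents (W : vectType k) (h : L * L -> L * L -> W) s s' r :
    (forall p, bilinear_for *:%R *:%R (fun u v => h p (u, v))) ->
    (forall q, bilinear_for *:%R *:%R (fun u v => h (u, v) q)) ->
    presents s r -> presents s' r ->
  \sum_(p <- s) \sum_(q <- s) h p q = \sum_(p <- s') \sum_(q <- s') h p q.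
Proof.
move=> hr hl sr s'r.
have swap (f : L -> L -> W) : bilinear_for *:%R *:%R f ->
    \sum_(p <- s) f p.1 p.2 = \sum_(p <- s') f p.1 p.2.
  move=> /tensor_universal[g [gE _]].
  transitivity (g r); [rewrite sr | rewrite s'r]; rewrite linear_sum;
    by apply: eq_bigr => p _; rewrite gE.
transitivity (\sum_(p <- s) \sum_(q <- s') h p q).
  apply: eq_bigr => p _.
  have E (q : L * L) : h p q = h p (q.1, q.2) by case: q.
  rewrite (eq_bigr _ (fun q _ => E q)) [RHS](eq_bigr _ (fun q _ => E q)).
  exact: swap (hr p).
rewrite exchange_big [RHS]exchange_big; apply: eq_bigr => q _ /=.
have E (p : L * L) : h p q = h (p.1, p.2) q by case: p.
rewrite (eq_bigr _ (fun p _ => E p)) [RHS](eq_bigr _ (fun p _ => E p)).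
exact: swap (hl q).
Qed.

Lemma yang_baxter_presents s s' r :
  presents s r -> presents s' r -> yang_baxter s = yang_baxter s'.
Proof.
have [ll lr] := @lie_bracket_bilinear k L.
have [tl tr] := tens_bilinear L L.
have [tl3 tr3] := tens_bilinear L (tensor L L).
move=> sr s'r; rewrite /yang_baxter; congr (_ + _ + _).
- apply: (@double_sum_presents _ (fun p q => [lie p.1, q.1] ⊗ (p.2 ⊗ q.2)))
    sr s'r => -[x y]; split=> [v a u1 u2|u a v1 v2] /=.
  + by rewrite lr tl3.
  + by rewrite tr tr3.
  + by rewrite ll tl3.
  + by rewrite tl tr3.
- apply: (@double_sum_presents _ (fun p q => p.1 ⊗ ([lie p.2, q.1] ⊗ q.2)))
    sr s'r => -[x y]; split=> [v a u1 u2|u a v1 v2] /=.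
  + by rewrite lr tl tr3.
  + by rewrite tr tr3.
  + by rewrite tl3.
  + by rewrite ll tl tr3.
- apply: (@double_sum_presents _ (fun p q => p.1 ⊗ (q.1 ⊗ [lie p.2, q.2])))
    sr s'r => -[x y]; split=> [v a u1 u2|u a v1 v2] /=.
  + by rewrite tl tr3.
  + by rewrite lr tr tr3.
  + by rewrite tl3.
  + by rewrite ll tr tr3.
Qed.

Lemma CYBE_presents s r :
  presents s r -> (CYBE_solution r <-> yang_baxter s = 0).
Proof.
move=> sr; split=> [|s0 s' s'r]; first exact.
by rewrite -(yang_baxter_presents sr s'r).
Qed.

End YangBaxter.

(* Main.v *)
Require Import Defs.
From HB Require Import structures.
From mathcomp Require Import all_boot all_order all_algebra ring.

(** Write r in the basis e1, e2, e3 as the tensor with coefficient matrix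
<<
      x p s
      q y u
      t v z
>>
    Comparing coefficients, the Yang-Baxter equation becomes 27 quadratic
    equations T(a, b, c) = 0 in the entries of this matrix and in beta, delta
    ([CYBE_coord]).  In characteristic 2 most of them vanish or coincide, and
    the others can be solved once and for all, without separating the four cases:

    - the sum of T(1, 1, 3) and T(3, 1, 1) is (s + t)^2, so t = s;
    - with t = s, the sum of T(2, 2, 3) and T(3, 2, 2) is delta (u + v)^2, so
      delta (u + v) = 0;
    - modulo these two relations, the system reduces to the seven further
      equations of [CYBE_conditions].

    [CYBE_conditionsP] proves that the 27 equations are equivalent to this reduced
    system, for all beta and delta.  Each part of the theorem is then read off:
    strongly symmetric coefficients satisfy p = q, s = t, u = v, x z = s^2 and
    p z = s u, which kill every condition; and the three characterizations are
    the reduced system at beta = 0 (with delta invertible, so u = v), at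
    delta = 1 (with beta invertible), and at beta = delta = 0.

    Coefficients in a triple tensor product are extracted one factor at a time by
    the slice maps of [tens_slices], which avoids choosing a basis of the tensor
    products themselves. *)

Set Implicit Arguments.
Unset Strict Implicit.
Unset Printing Implicit Defensive.

Import GRing.Theory.
Local Open Scope ring_scope.

(** * Coordinates in tensor products *)

Lemma tens_ext (k : fieldType) (U V W : vectType k)
    (f g : {linear tensor U V -> W}) :
  (forall u v, f (u ⊗ v) = g (u ⊗ v)) -> f =1 g.
Proof.
move=> eq_fg w; rewrite (tens_basis w) !linear_sum; apply: eq_bigr => i _.
by rewrite !linear_sum; apply: eq_bigr => j _; rewrite !linearZ /= eq_fg.
Qed.

(** The i-th slice is the map coord_i ⊗ id: it replaces the first tensor factor by
    its i-th coordinate.  Applying slices repeatedly reads off coefficients in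
    iterated tensor products. *)
Lemma tens_slices (k : fieldType) (U V : vectType k) n (e : n.-tuple U) :
    basis_of fullv e ->
  exists g : 'I_n -> {linear tensor U V -> V},
    (forall i u v, g i (u ⊗ v) = coord e i u *: v) /\
    (forall w : tensor U V, w = \sum_i tnth e i ⊗ g i w).
Proof.
move=> e_basis.
have slice_ex i : exists g : {linear tensor U V -> V},
    forall u v, g (u ⊗ v) = coord e i u *: v.
  have [|g [gE _]] := @tensor_universal k U V V (fun u v => coord e i u *: v).
    split=> [v a u1 u2|u a v1 v2] /=.
      by rewrite linearP scalerDl scalerA.
    by rewrite scalerDr !scalerA mulrC.
  by exists g.
have [g gE] := fin_all_exists slice_ex; exists g; split=> // w.
(* Both sides of the expansion are linear in w, so pure tensors suffice. *)
pose h0 (w : tensor U V) := \sum_i tnth e i ⊗ g i w.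
have h0P : linear h0.
  move=> a w1 w2; rewrite /h0 scaler_sumr -big_split; apply: eq_bigr => i _ /=.
  by rewrite linearP linearDr linearZr_LR.
pose h : {linear tensor U V -> tensor U V} :=
  HB.pack h0 (GRing.isLinear.Build k _ _ _ h0 h0P).
apply: (@tens_ext k U V _ idfun h) => u v; rewrite /= /h0.
rewrite [in LHS](coord_basis e_basis (memvf u)) linear_sumlz.
apply: eq_bigr => i _; rewrite gE -(tnth_nth 0).
by rewrite linearZl_LR linearZr_LR.
Qed.

Lemma coordE (k : fieldType) (L : vectType k) n (e : n.-tuple L) :
  basis_of fullv e -> forall u, u = \sum_i coord e i u *: tnth e i.
Proof.
move=> e_basis u; rewrite [LHS](coord_basis e_basis (memvf u)).
by apply: eq_bigr => i _; rewrite -tnth_nth.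
Qed.

Lemma coord_sumE (k : fieldType) (L : vectType k) n (e : n.-tuple L)
    (a : 'I_n -> k) i :
  basis_of fullv e -> coord e i (\sum_j a j *: tnth e j) = a i.
Proof.
move=> /basis_free e_free; rewrite (eq_bigr (fun j : 'I_n => a j *: e`_j)).
  exact: coord_sum_free.
by move=> j _; rewrite -tnth_nth.
Qed.

Lemma tens_coordE (k : fieldType) (U V : vectType k) m n
    (e : m.-tuple U) (f : n.-tuple V) (r : tensor U V) :
    basis_of fullv e -> basis_of fullv f ->
  exists K : 'M[k]_(m, n), r = \sum_i \sum_j K i j *: (tnth e i ⊗ tnth f j).
Proof.
move=> e_basis f_basis; have [g [_ rE]] := tens_slices V e_basis.
exists (\matrix_(i, j) coord f j (g i r)); rewrite {1}(rE r).
apply: eq_bigr => i _; rewrite {1}(coordE f_basis (g i r)) linear_sumr.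
by apply: eq_bigr => j _; rewrite linearZr_LR mxE.
Qed.

(** * The Yang-Baxter equation in coordinates *)

(** The coefficient of e_a ⊗ (e_b ⊗ e_c) in the Yang-Baxter expression, when r has
    matrix K and the Lie algebra has structure constants C; the three terms come
    from [r12, r13], [r12, r23] and [r13, r23] in this order. *)
Definition yb_coef (k : fieldType) n (C : 'I_n -> 'I_n -> 'I_n -> k)
    (K : 'M[k]_n) (a b c : 'I_n) : k :=
  \sum_i \sum_j (K i b * K j c * C i j a + K a i * K j c * C i j b
                 + K a i * K b j * C i j c).

(** The presentation of r as the sum of the e_i ⊗ (\sum_j K i j *: e_j) has only n
    terms and a basis as its first components, so that slicing collapses one sum
    in [r12, r23] and two in [r13, r23]. *)
Lemma CYBE_coord (k : fieldType) (L : lieAlgType k) n (e : n.-tuple L)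
    (C : 'I_n -> 'I_n -> 'I_n -> k) (K : 'M[k]_n) :
    basis_of fullv e ->
    (forall i j, [lie tnth e i, tnth e j] = \sum_l C i j l *: tnth e l) ->
  CYBE_solution (\sum_i \sum_j K i j *: (tnth e i ⊗ tnth e j)) <->
  (forall a b c, yb_coef C K a b c = 0).
Proof.
move=> e_basis CE.
pose f i := \sum_j K i j *: tnth e j.
pose s := [seq (tnth e i, f i) | i <- index_enum 'I_n].
have sr : presents s (\sum_i \sum_j K i j *: (tnth e i ⊗ tnth e j)).
  rewrite /presents big_map; apply: eq_bigr => i _ /=.
  by rewrite linear_sumr; apply: eq_bigr => j _; rewrite linearZr_LR.
rewrite (CYBE_presents sr).
have [g2 [g2E r2E]] := tens_slices L e_basis.
have [g3 [g3E r3E]] := tens_slices (tensor L L) e_basis.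
have coord0P (w : tensor L (tensor L L)) :
    (w = 0) <-> (forall a b c, coord e c (g2 b (g3 a w)) = 0).
  split=> [-> a b c | w0]; first by rewrite !linear0.
  rewrite (r3E w) big1 // => a _; rewrite (r2E (g3 a w)) big1 ?linear0r// => b _.
  rewrite (coordE e_basis (g2 b _)) big1 ?linear0r// => c _.
  by rewrite w0 scale0r.
have coord_f i b : coord e b (f i) = K i b by rewrite coord_sumE.
have coord_e i b : coord e b (tnth e i) = (i == b)%:R.
  by rewrite (tnth_nth 0) coord_free // (basis_free e_basis).
have coord_C i j l : coord e l [lie tnth e i, tnth e j] = C i j l.
  by rewrite CE coord_sumE.
suff ybE a b c : coord e c (g2 b (g3 a (yang_baxter s))) = yb_coef C K a b c.
  by rewrite coord0P; split=> h a b c; [rewrite -ybE | rewrite ybE]; exact: h.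
rewrite /yb_coef; under eq_bigr do rewrite big_split big_split /=.
rewrite big_split big_split /= /yang_baxter !linearD /=; congr (_ + _ + _).
- rewrite /lie_r12_r13 big_map !linear_sum; apply: eq_bigr => i _.
  rewrite big_map !linear_sum; apply: eq_bigr => j _ /=.
  by rewrite g3E linearZ /= g2E !linearZ /= !coord_f coord_C; ring.
- rewrite /lie_r12_r23 big_map !linear_sum (bigD1 a) //=.
  rewrite [X in _ + X]big1 ?addr0; last first.
    move=> i /negPf ia; rewrite big_map !linear_sum big1 // => j _.
    by rewrite g3E coord_e ia scale0r !linear0.
  rewrite big_map !linear_sum exchange_big; apply: eq_bigr => j _ /=.
  rewrite g3E coord_e eqxx scale1r g2E !linearZ /= coord_f.
  rewrite /f linear_sumlz linear_sum mulr_suml; apply: eq_bigr => i _.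
  by rewrite linearZl_LR linearZ /= coord_C; ring.
- rewrite /lie_r13_r23 big_map !linear_sum (bigD1 a) //=.
  rewrite [X in _ + X]big1 ?addr0; last first.
    move=> i /negPf ia; rewrite big_map !linear_sum big1 // => j _.
    by rewrite g3E coord_e ia scale0r !linear0.
  rewrite big_map !linear_sum (bigD1 b) //= big1 ?addr0; last first.
    move=> j /negPf jb.
    by rewrite g3E linearZ /= g2E !coord_e jb scale0r scaler0 linear0.
  rewrite g3E linearZ /= g2E !coord_e !eqxx !scale1r.
  rewrite {1}/f linear_sumlz linear_sum; apply: eq_bigr => i _ /=.
  rewrite linearZl_LR linearZ /= /f linear_sumr linear_sum mulr_sumr.
  by apply: eq_bigr => j _ /=; rewrite linearZr_LR linearZ /= coord_C; ring.
Qed.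

(** * Reduction of the 27 equations in characteristic 2 *)

Local Notation o1 := (@Ordinal 3 0 isT).
Local Notation o2 := (@Ordinal 3 1 isT).
Local Notation o3 := (@Ordinal 3 2 isT).

Lemma sum_ord3 (V : nmodType) (F : 'I_3 -> V) :
  \sum_i F i = F o1 + F o2 + F o3.
Proof.
rewrite !big_ord_recr big_ord0 /= add0r.
by congr (F _ + F _ + F _); apply: val_inj.
Qed.

Definition mx3 (k : fieldType) (p q s t u v x y z : k) : 'M[k]_3 :=
  \matrix_(i, j) (nth [::] [:: [:: x; p; s]; [:: q; y; u]; [:: t; v; z]] i)`_j.

(** Structure constants of the Lie algebra of the theorem.  The table is symmetric
    in i and j because signs disappear in characteristic 2. *)
Definition lie_const (k : fieldType) (beta delta : k) (i j l : 'I_3) : k :=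
  (nth [::] (nth [::]
     [:: [:: [::]; [::]; [:: 1; beta]];
         [:: [::]; [::]; [:: 0; delta]];
         [:: [:: 1; beta]; [:: 0; delta]; [::]]] i) j)`_l.

(** The reduced system.  The suffix abc of a field tells which coefficient of
    e_a ⊗ (e_b ⊗ e_c) gives that equation, up to multiples of the other fields. *)
Record CYBE_conditions (k : fieldType) (beta delta p q s t u v x z : k) :
    Prop := CYBEConditions {
  cond_st : t = s;
  cond_uv : delta * (u + v) = 0;
  cond_121 : x * (u + v) + (delta + 1) * (s * (p + q)) = 0;
  cond_122 : beta * (x * (u + v) + s * (p + q)) = 0;
  cond_212 : (delta + 1) * (q * v + p * u) = 0;
  cond_222 : beta * (q * v + p * u) = 0;
  cond_232 : beta * (z * (p + q) + s * (u + v)) = 0;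
  cond_132 : (delta + 1) * (p * z + s * v) + beta * (x * z + s ^+ 2) = 0;
  cond_213 : (delta + 1) * (q * z + s * u) + beta * (x * z + s ^+ 2) = 0
}.

Lemma char2_addr_eq0 (k : fieldType) (a b : k) :
  2%N \in [pchar k] -> a + b = 0 <-> a = b.
Proof.
move=> char2; split=> [/eqP|->]; last exact: addrr_pchar2.
by rewrite addr_eq0 oppr_pchar2 // => /eqP.
Qed.

Lemma eq0_addM (k : fieldType) (w c d f : k) :
  c = 0 -> d = 0 -> f = c + w * d -> f = 0.
Proof. by move=> -> -> ->; rewrite mulr0 addr0. Qed.
Arguments eq0_addM {k} w {c d f}.

(** The sums of coefficients 113 + 311 and 223 + 322 are squares, the latter up to a
    factor delta; this forces t = s and delta * (u + v) = 0.  Modulo these two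
    relations, every other coefficient is a combination of reduced equations. *)
Lemma CYBE_conditionsP (k : fieldType) (beta delta p q s t u v x y z : k) :
    2%N \in [pchar k] ->
  (forall a b c,
     yb_coef (lie_const beta delta) (mx3 p q s t u v x y z) a b c = 0) <->
  CYBE_conditions beta delta p q s t u v x z.
Proof.
(* The ring tactic cancels only literal coefficients 2, hence the equations for *)
(* the coefficients 3 and 4 that also occur.                                    *)
move=> pchar2; have char2 : 2%:R = 0 :> k := pcharf0 pchar2.
have char3 : 3%:R = 1 :> k by rewrite mulrS char2 addr0.
have char4 : 4%:R = 0 :> k by rewrite (natrM _ 2 2) char2 mulr0.
have sqr_eq0 (a : k) : a * a = 0 -> a = 0.
  by move=> /eqP; rewrite mulf_eq0 orbb => /eqP.
split=> [T | [ts Cuv C121 C122 C212 C222 C232 C132 C213]]; last first.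
  (* Left by ring, in this order: coefficient 111, which is 6 * (x * s), then    *)
  (* 121, 122, 123, 132, 212, 213, 221, 222, 223, 231, 232, 312, 321, 322, 323. *)
  subst t.
  case=> [[|[|[|//]]] ?] [[|[|[|//]]] ?] [[|[|[|//]]] ?];
    rewrite /yb_coef !sum_ord3 /lie_const !mxE /=; try by ring: char2.
  - by apply: (eq0_addM (x * s *+ 3) (erefl 0) char2); ring.
  - by rewrite -[RHS]C121; ring: char2.
  - by apply: (eq0_addM p C122 Cuv); ring: char2.
  - by apply: (eq0_addM s C132 Cuv); ring: char2.
  - by rewrite -[RHS]C132; ring: char2.
  - by apply: (eq0_addM 1 C122 C212); ring: char2.
  - by rewrite -[RHS]C213; ring: char2.
  - by apply: (eq0_addM q C122 Cuv); ring: char2.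
  - by apply: (eq0_addM y C222 Cuv); ring: char2 char3.
  - by apply: (eq0_addM u C232 Cuv); ring: char2.
  - by rewrite -[RHS]C213; ring: char2.
  - by rewrite -[RHS]C232; ring: char2.
  - by rewrite -[RHS]C132; ring: char2.
  - by apply: (eq0_addM s C213 Cuv); ring: char2.
  - by apply: (eq0_addM v C232 Cuv); ring: char2.
  - by apply: (eq0_addM z (erefl 0) Cuv); ring: char2.
have ts : t = s.
  apply/char2_addr_eq0 => //; apply: sqr_eq0.
  have := T o1 o1 o3; have := T o3 o1 o1.
  rewrite /yb_coef !sum_ord3 /lie_const !mxE /= => T311 T113.
  by apply: (eq0_addM 1 T311 T113); ring: char2 char4.
subst t.
have C232 : beta * (z * (p + q) + s * (u + v)) = 0.
  rewrite -(T o2 o3 o2) /yb_coef !sum_ord3 /lie_const !mxE /=; ring: char2.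
have Cuv : delta * (u + v) = 0.
  have := T o2 o2 o3; have := T o3 o2 o2.
  rewrite /yb_coef !sum_ord3 /lie_const !mxE /= => T322 T223.
  have sq0 : delta * ((u + v) * (u + v)) = 0.
    by apply: (eq0_addM 1 T322 T223); ring: char2 char4.
  by apply: sqr_eq0; apply: (eq0_addM delta (erefl 0) sq0); ring.
have C122 : beta * (x * (u + v) + s * (p + q)) = 0.
  have := T o1 o2 o2; rewrite /yb_coef !sum_ord3 /lie_const !mxE /= => T122.
  by apply: (eq0_addM p T122 Cuv); ring: char2.
split=> //.
- by rewrite -(T o1 o2 o1) /yb_coef !sum_ord3 /lie_const !mxE /=; ring: char2.
- have := T o2 o1 o2; rewrite /yb_coef !sum_ord3 /lie_const !mxE /= => T212.
  by apply: (eq0_addM 1 T212 C122); ring: char2.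
- have := T o2 o2 o2; rewrite /yb_coef !sum_ord3 /lie_const !mxE /= => T222.
  by apply: (eq0_addM y T222 Cuv); ring: char2 char4.
- by rewrite -(T o1 o3 o2) /yb_coef !sum_ord3 /lie_const !mxE /=; ring: char2.
- by rewrite -(T o2 o1 o3) /yb_coef !sum_ord3 /lie_const !mxE /=; ring: char2.
Qed.

(** * The classification *)

Definition tens3 (k : fieldType) (L : vectType k) (e1 e2 e3 : L)
    (p q s t u v x y z : k) : tensor L L :=
  p *: (e1 ⊗ e2) + q *: (e2 ⊗ e1) + s *: (e1 ⊗ e3) + t *: (e3 ⊗ e1)
  + u *: (e2 ⊗ e3) + v *: (e3 ⊗ e2) + x *: (e1 ⊗ e1) + y *: (e2 ⊗ e2)
  + z *: (e3 ⊗ e3).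

Lemma tens3E (k : fieldType) (L : vectType k) (e1 e2 e3 : L) (K : 'M[k]_3)
    (e := [tuple e1; e2; e3]) :
  \sum_i \sum_j K i j *: (tnth e i ⊗ tnth e j)
    = tens3 e1 e2 e3 (K o1 o2) (K o2 o1) (K o1 o3) (K o3 o1) (K o2 o3) (K o3 o2)
        (K o1 o1) (K o2 o2) (K o3 o3).
Proof.
rewrite !sum_ord3 !(tnth_nth 0) /tens3 /= !addrA.
by rewrite [LHS](ACl (2*4*3*7*6*8*1*5*9)).
Qed.

Lemma CYBE_tens3 (k : fieldType) (L : lieAlgType k) (e1 e2 e3 : L)
    (beta delta p q s t u v x y z : k) :
    2%N \in [pchar k] -> basis_of fullv [:: e1; e2; e3] ->
    [lie e1, e2] = 0 -> [lie e1, e3] = e1 + beta *: e2 ->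
    [lie e2, e3] = delta *: e2 ->
  CYBE_solution (tens3 e1 e2 e3 p q s t u v x y z) <->
  CYBE_conditions beta delta p q s t u v x z.
Proof.
move=> pchar2 e_basis e12 e13 e23.
(* An alternating bracket is symmetric in characteristic 2. *)
have lieC (a b : L) : [lie b, a] = [lie a, b].
  have := lie_bracketxx (a + b).
  rewrite linearDr !linearDl /= !lie_bracketxx add0r addr0 => /eqP.
  rewrite addr_eq0 => /eqP ->; rewrite -scaleN1r.
  by rewrite oppr_pchar2 ?scale1r.
have -> : tens3 e1 e2 e3 p q s t u v x y z =
    \sum_i \sum_j mx3 p q s t u v x y z i j *:
      (tnth [tuple e1; e2; e3] i ⊗ tnth [tuple e1; e2; e3] j).
  by rewrite tens3E !mxE.
rewrite -(CYBE_conditionsP beta delta p q s t u v x y z pchar2).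
apply: CYBE_coord => // i j.
case: i => [[|[|[|//]]] ?]; case: j => [[|[|[|//]]] ?];
  rewrite sum_ord3 !(tnth_nth 0) /lie_const /= ?lie_bracketxx //
    ?e12 ?e13 ?e23 ?scale1r ?scale0r ?add0r ?addr0 //; rewrite lieC.
all: by rewrite ?e12 ?e13 ?e23.
Qed.

Theorem proposition2p4 (k : fieldType) (char_k : 2%N \in [pchar k])
    (L : lieAlgType k) (e1 e2 e3 : L) (beta delta : k)
    (e_basis : basis_of fullv [:: e1; e2; e3])
    (e12 : [lie e1, e2] = 0)
    (e13 : [lie e1, e3] = e1 + beta *: e2)
    (e23 : [lie e2, e3] = delta *: e2)
    (r : tensor L L) :
  [/\
   (* (I) *)
   strongly_symmetric [tuple e1; e2; e3] r -> CYBE_solution r,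
   (* (II) *)
   beta = 0 -> delta != 0 ->
     (CYBE_solution r <->
      exists p q s u x y z : k,
        [/\ r = p *: (e1 ⊗ e2) + q *: (e2 ⊗ e1)
                + s *: (e1 ⊗ e3) + s *: (e3 ⊗ e1)
                + u *: (e2 ⊗ e3) + u *: (e3 ⊗ e2)
                + x *: (e1 ⊗ e1) + y *: (e2 ⊗ e2) + z *: (e3 ⊗ e3),
            (delta + 1) * z * p = (delta + 1) * q * z /\
            (delta + 1) * q * z = (delta + 1) * u * s,
            (delta + 1) * u * q = (delta + 1) * u * p
          & (delta + 1) * p * s = (delta + 1) * q * s]),
   (* (III) *)
   beta != 0 -> delta = 1 ->
     (CYBE_solution r <->
      exists p q s u x y z : k,
        [/\ r = p *: (e1 ⊗ e2) + q *: (e2 ⊗ e1)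
                + s *: (e1 ⊗ e3) + s *: (e3 ⊗ e1)
                + u *: (e2 ⊗ e3) + u *: (e3 ⊗ e2)
                + x *: (e1 ⊗ e1) + y *: (e2 ⊗ e2) + z *: (e3 ⊗ e3),
            s * p = s * q, u * p = q * u, z * q = z * p
          & s ^+ 2 = x * z])
   & (* (IV) *)
   beta = 0 -> delta = 0 ->
     (CYBE_solution r <->
      exists p q s u v x y z : k,
        [/\ r = p *: (e1 ⊗ e2) + q *: (e2 ⊗ e1)
                + s *: (e1 ⊗ e3) + s *: (e3 ⊗ e1)
                + u *: (e2 ⊗ e3) + v *: (e3 ⊗ e2)
                + x *: (e1 ⊗ e1) + y *: (e2 ⊗ e2) + z *: (e3 ⊗ e3),
            v * s = p * z, u * s = q * z, q * v = p * u
          & (u + v) * x = (p + q) * s])].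
Proof.
have solP p q s t u v x y z :=
  CYBE_tens3 p q s t u v x y z char_k e_basis e12 e13 e23.
(* An equation between two terms is the vanishing of their sum. *)
have eq_sum0 (a b : k) : a + b = 0 <-> a = b by exact: char2_addr_eq0.
have char2 : 2%:R = 0 :> k := pcharf0 char_k.
have [p [q [s [t [u [v [x [y [z rE]]]]]]]]] : exists p q s t u v x y z,
    r = tens3 e1 e2 e3 p q s t u v x y z.
  have [K ->] := tens_coordE r (e_basis : basis_of fullv [tuple e1; e2; e3])
                   (e_basis : basis_of fullv [tuple e1; e2; e3]).
  by rewrite tens3E; do 9!eexists.
split.
- move=> [K [-> K_sym K_exch]]; rewrite tens3E; apply/solP.
  rewrite (K_sym o2 o1) (K_sym o3 o1) (K_sym o3 o2).
  have xz := K_exch o1 o1 o3 o3; have pz := K_exch o1 o2 o3 o3.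
  by split=> //; rewrite ?pz ?xz; ring: char2.
- move=> beta0 delta_neq0; split=> [|[p' [q' [s' [u' [x' [y' [z']]]]]]]].
    rewrite rE solP beta0 => -[-> Cuv C121 _ C212 _ _ C132 C213].
    move/eqP: Cuv; rewrite mulf_eq0 (negPf delta_neq0) => /eqP/eq_sum0 uv.
    rewrite -uv in C121 C212 C132 *.
    exists p, q, s, u, x, y, z; split=> //; first split; apply/eq_sum0.
    - by apply: (eq0_addM 1 C132 C213); ring: char2.
    - by rewrite -C213; ring: char2.
    - by rewrite -C212; ring: char2.
    - by rewrite -C121; ring: char2.
  move=> [-> [/eq_sum0 C1 /eq_sum0 C2] /eq_sum0 C3 /eq_sum0 C4].
  apply/solP; rewrite beta0; split=> //; try by ring: char2.
  - by rewrite -[RHS]C4; ring: char2.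
  - by rewrite -[RHS]C3; ring: char2.
  - by apply: (eq0_addM 1 C1 C2); ring: char2.
  - by rewrite -[RHS]C2; ring: char2.
- move=> beta_neq0 delta1; split=> [|[p' [q' [s' [u' [x' [y' [z']]]]]]]].
    have cancel w : beta * w = 0 -> w = 0.
      by move=> /eqP; rewrite mulf_eq0 (negPf beta_neq0) => /eqP.
    rewrite rE solP delta1 => -[-> Cuv _ C122 _ C222 C232 C132 _].
    move: Cuv; rewrite mul1r => /eq_sum0 uv.
    rewrite -uv in C122 C222 C232 C132 *.
    exists p, q, s, u, x, y, z; split=> //; apply/eq_sum0; apply: cancel.
    - by rewrite -C122; ring: char2.
    - by rewrite -C222; ring: char2.
    - by rewrite -C232; ring: char2.
    - by rewrite -C132; ring: char2.
  move=> [-> /eq_sum0 C1 /eq_sum0 C2 /eq_sum0 C3 /eq_sum0 C4].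
  apply/solP; rewrite delta1; split=> //; try by ring: char2.
  - by apply: (eq0_addM beta (erefl 0) C1); ring: char2.
  - by apply: (eq0_addM beta (erefl 0) C2); ring: char2.
  - by apply: (eq0_addM beta (erefl 0) C3); ring: char2.
  - by apply: (eq0_addM beta (erefl 0) C4); ring: char2.
  - by apply: (eq0_addM beta (erefl 0) C4); ring: char2.
- move=> beta0 delta0; split=> [|[p' [q' [s' [u' [v' [x' [y' [z']]]]]]]]].
    rewrite rE solP beta0 delta0 => -[-> _ C121 _ C212 _ _ C132 C213].
    exists p, q, s, u, v, x, y, z; split=> //; apply/eq_sum0.
    - by rewrite -C132; ring.
    - by rewrite -C213; ring.
    - by rewrite -C212; ring.
    - by rewrite -C121; ring.
  move=> [-> /eq_sum0 C1 /eq_sum0 C2 /eq_sum0 C3 /eq_sum0 C4].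
  apply/solP; rewrite beta0 delta0; split=> //; try by ring: char2.
  - by rewrite -[RHS]C4; ring.
  - by rewrite -[RHS]C3; ring.
  - by rewrite -[RHS]C1; ring.
  - by rewrite -[RHS]C2; ring.
Qed.
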